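(* Let $Q$ be a quantale and let $\Sigma_Q$ be a class of proper ideals of $Q$ that contains the zero ideal $\theta$. Then the quantale space $\Sigma_Q$ is connected.
   Context: A quantale here means a complete lattice $(Q,\preccurlyeq,\bot,\top)$ with a binary operation $\&$ that is associative, commutative, satisfies $x\&\bigl(\bigvee_{\lambda} y_\lambda\bigr)=\bigvee_\lambda (x\& y_\lambda)$ for all families, and satisfies $x\&\top=x$ for all $x$. An ideal of $Q$ is a nonempty subset $I\subseteq Q$ such that $x,y\in I$ implies $x\vee y\in I$, and $x\in I$, $l\preccurlyeq x$ imply $l\in I$. $\mathcal I_Q$ is the set of all ideals of $Q$ and $\theta=\{\bot\}$ is the zero ideal. An ideal is proper if $I\neq Q$. For a set $\Sigma_Q$ of proper ideals of $Q$ and $X\subseteq \mathcal I_Q$, put $X^{\uparrow}=\{J\in\Sigma_Q\mid \bigcap X\subseteq J\}$ if $X\neq\emptyset$ and $\emptyset^{\uparrow}=\emptyset$. The quantale topology on $\Sigma_Q$ is the topology having the sets $X^{\uparrow}$ ($X\subseteq \mathcal I_Q$) as a subbasis of closed sets; $\Sigma_Q$ with this topology is called a quantale space. *)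

(* Defs.v *)
From HB Require Import structures.
From mathcomp Require Import all_boot all_order.
From mathcomp Require Import mathcomp_extra boolp classical_sets functions.
From mathcomp Require Import topology.

Set Implicit Arguments.
Unset Strict Implicit.
Unset Printing Implicit Defensive.

Local Open Scope classical_set_scope.

HB.mixin Record isCompleteLattice (d : Order.disp_t) T & Order.TBLattice d T := {
  bigjoin : set T -> T;
  bigmeet : set T -> T;
  bigjoin_supremum : forall A : set T, supremums A (bigjoin A);
  bigmeet_infimum : forall A : set T, infimums A (bigmeet A)
}.

#[short(type="completeLatticeType")]
HB.structure Definition CompleteLattice d :=
  { T of Order.TBLattice d T & isCompleteLattice d T }.

(* A family (y_i) enters a join only through its set of values, so
   distributivity over arbitrary families is stated over subsets. *)
HB.mixin Record isQuantale (d : Order.disp_t) T & CompleteLattice d T := {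
  qmul : T -> T -> T;
  qmulA : associative qmul;
  qmulC : commutative qmul;
  qmul_bigjoinr : forall (x : T) (A : set T),
    qmul x (bigjoin A) = bigjoin [set qmul x y | y in A];
  qmulx1 : right_id (\top%O : T) qmul
}.

#[short(type="quantaleType")]
HB.structure Definition Quantale d :=
  { T of CompleteLattice d T & isQuantale d T }.

Section Ideals.
Context {d : Order.disp_t} {Q : quantaleType d}.

Definition is_ideal (I : set Q) : Prop :=
  [/\ I !=set0,
      forall x y, I x -> I y -> I (Order.join x y) &
      forall x l, I x -> (l <= x)%O -> I l].

Definition ideals : set (set Q) := [set I | is_ideal I].

Definition proper_ideals : set (set Q) := [set I | is_ideal I /\ I <> setT].

Definition zero_ideal : set Q := [set \bot%O].

End Ideals.

(* The points of the space are the elements of Sigma. The alias keeps its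
   topology apart from the initial topology the library puts on [set_type]. *)
Definition quantale_space d (Q : quantaleType d) (Sigma : set (set Q)) : Type :=
  set_type Sigma.

Section QuantaleTopology.
Context {d : Order.disp_t} {Q : quantaleType d} (Sigma : set (set Q)).

HB.instance Definition _ :=
  Choice.copy (quantale_space Sigma) (set_type Sigma).

(* The condition [X !=set0] makes the value at the empty X be the empty set;
   without it the empty intersection would be setT. *)
Definition up (X : set (set Q)) : set (quantale_space Sigma) :=
  [set J | X !=set0 /\ \bigcap_(I in X) I `<=` \val (J : set_type Sigma)].

(* The sets [up X], for X a set of ideals, form a subbasis of closed sets iff
   their complements form a subbasis of open sets. *)
HB.instance Definition _ :=
  @isSubBaseTopological.Build (quantale_space Sigma)
    (set (set Q)) [set X | X `<=` ideals] (fun X => ~` up X).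

End QuantaleTopology.

Arguments up {d Q} Sigma X _.

(* Main.v *)
(** A subbasic closed set containing the zero ideal is the whole space, because
    the zero ideal lies below every ideal.  So every nonempty open set contains
    the zero ideal, i.e. the zero ideal is a generic point, and the space is the
    closure of a single point. *)
Require Import Defs.
From HB Require Import structures.
From mathcomp Require Import all_boot all_order.
From mathcomp Require Import mathcomp_extra boolp classical_sets functions.
From mathcomp Require Import topology.

Local Open Scope classical_set_scope.

Lemma zero_ideal_sub (d : Order.disp_t) (Q : quantaleType d) (I : set Q) :
  is_ideal I -> zero_ideal `<=` I.
Proof.
case=> -[x Ix] _ Idown _ ->.
by apply: (Idown x) => //; exact: Order.BPreorderTheory.le0x.
Qed.

Section GenericPoint.
Context {d : Order.disp_t} {Q : quantaleType d} {Sigma : set (set Q)}.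
Context (Sigma_proper : Sigma `<=` proper_ideals).

Lemma up_zero_idealT (t : quantale_space Sigma) (X : set (set Q)) :
  \val (t : set_type Sigma) = zero_ideal -> up Sigma X t -> up Sigma X = setT.
Proof.
move=> t0 [X0 Xt]; apply/seteqP; split=> // J _; split=> //.
apply: subset_trans Xt _; rewrite t0; apply: zero_ideal_sub.
by have /Sigma_proper[] := set_valP (J : set_type Sigma).
Qed.

Lemma open_zero_ideal (t : quantale_space Sigma) (U : set (quantale_space Sigma)) :
  \val (t : set_type Sigma) = zero_ideal -> open U -> U !=set0 -> U t.
Proof.
(* [open U] computes to: [U] is a union of sets [V] in [B], each a finite
   intersection of sets [~` up Sigma X]. *)
move=> t0 [B Bfin <-] [J [V BV VJ]]; exists V; first exact: BV.
have [F _ FV] := Bfin _ BV; suff: V J -> V t by exact.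
(* If [t] lay in [up Sigma X] for some [X] in [F], that set would be the whole space and so contain
   [J], against [J] lying in [V]. *)
rewrite -FV => FJ X FX tX.
by apply: (FJ X FX); rewrite (up_zero_idealT t X t0 tX).
Qed.

End GenericPoint.

Theorem theorem6p2 (d : Order.disp_t) (Q : quantaleType d)
    (Sigma : set (set Q))
    (Sigma_proper : Sigma `<=` proper_ideals)
    (Sigma_zero : Sigma zero_ideal) :
  connected [set: quantale_space Sigma].
Proof.
pose t : quantale_space Sigma := SigSub (mem_set Sigma_zero).
(* The closure of a connected set is connected, so it is enough that the singleton of [t] is
   dense. *)
suff <- : closure [set t] = setT by exact/connected_closure/connected1.
apply/seteqP; split=> // J _ V; rewrite nbhsE => -[U [oU UJ] UV].
(* The open neighbourhood [U] of [J] is nonempty, since it contains [J]; hence it also contains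
   [t]. *)
exists t; split=> //; apply: UV.
by apply: (open_zero_ideal Sigma_proper) => //; exists J.
Qed.
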